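(* Let $(\mathcal{A},\cdot,\alpha)$ be a commutative Hom-associative algebra and let $\partial$ be a derivation of $(\mathcal{A},\cdot)$ such that $\partial\alpha=\alpha\partial$. Define a new operation on $\mathcal{A}$ by $x\star y=x\cdot\partial(y)$ for all $x,y\in\mathcal{A}$. Then $(\mathcal{A},\cdot,\star,\alpha)$ is a Hom-Novikov-Poisson algebra (with $\cdot$ the commutative Hom-associative product and $\star$ the Hom-Novikov product).
   Context: All vector spaces are over a field $\mathbb{F}$ of characteristic zero. A derivation of $(\mathcal{A},\cdot)$ is a linear map $\partial:\mathcal{A}\to\mathcal{A}$ with $\partial(x\cdot y)=\partial(x)\cdot y+x\cdot\partial(y)$ for all $x,y\in\mathcal{A}$. A commutative Hom-associative algebra $(\mathcal{A},\cdot,\alpha)$ is a vector space $\mathcal{A}$ with a commutative bilinear product $\cdot$ and a linear map $\alpha:\mathcal{A}\to\mathcal{A}$ such that $\alpha(x)\cdot(y\cdot z)=(x\cdot y)\cdot\alpha(z)$ for all $x,y,z$. A Hom-Novikov algebra $(\mathcal{A},\ast,\alpha)$ is a vector space with a bilinear product $\ast$ and an algebra homomorphism $\alpha$ (linear with $\alpha(x\ast y)=\alpha(x)\ast\alpha(y)$) satisfying $(x\ast y)\ast\alpha(z)=(x\ast z)\ast\alpha(y)$ and $(x\ast y)\ast\alpha(z)-\alpha(x)\ast(y\ast z)=(y\ast x)\ast\alpha(z)-\alpha(y)\ast(x\ast z)$ for all $x,y,z$. A Hom-Novikov-Poisson algebra is a quadruple $(\mathcal{A},\cdot,\ast,\alpha)$,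 where $\mathcal{A}$ is a vector space, $\cdot$ and $\ast$ are bilinear operations and $\alpha$ is an algebra homomorphism of $\mathcal{A}$ (linear, preserving both operations), such that $(\mathcal{A},\ast,\alpha)$ is a Hom-Novikov algebra, $(\mathcal{A},\cdot,\alpha)$ is a commutative Hom-associative algebra, and for all $x,y,z$: $(x\cdot y)\ast\alpha(z)=\alpha(x)\cdot(y\ast z)$ and $(x\ast y)\cdot\alpha(z)-\alpha(x)\ast(y\cdot z)=(y\ast x)\cdot\alpha(z)-\alpha(y)\ast(x\cdot z)$.
   Formalization: The formal theorem additionally assumes that α preserves the product, α(x·y)=α(x)·α(y), which the conclusion requires but the hypotheses do not give (for 𝒜=𝔽, α(x)=2x, ∂=0 the claim as stated fails). *)

(* Defs.v *)
From HB Require Import structures.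
From mathcomp Require Import all_boot all_algebra.

Set Implicit Arguments.
Unset Strict Implicit.
Unset Printing Implicit Defensive.

Import GRing.Theory.
Local Open Scope ring_scope.

Section HomAlgebras.

Variables (F : fieldType) (A : lmodType F).
Implicit Types (mul star : A -> A -> A) (alpha d : A -> A).

Definition bilinear_op mul : Prop := bilinear_for *:%R *:%R mul.

Definition multiplicative_for mul alpha : Prop :=
  forall x y, alpha (mul x y) = mul (alpha x) (alpha y).

Definition derivation mul d : Prop :=
  linear d /\ forall x y, d (mul x y) = mul (d x) y + mul x (d y).

(* The twisting map is only required to be linear here; multiplicativity is
   demanded separately where it is needed. *)
Record comm_Hom_associative mul alpha : Prop := CommHomAssociative {
  cha_bilinear : bilinear_op mul;
  cha_linear : linear alpha;
  cha_commutative : commutative mul;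
  cha_Hom_associative :
    forall x y z, mul (alpha x) (mul y z) = mul (mul x y) (alpha z)
}.

Record Hom_Novikov star alpha : Prop := HomNovikov {
  hn_bilinear : bilinear_op star;
  hn_linear : linear alpha;
  hn_multiplicative : multiplicative_for star alpha;
  hn_right_commutative :
    forall x y z, star (star x y) (alpha z) = star (star x z) (alpha y);
  hn_left_symmetric :
    forall x y z,
      star (star x y) (alpha z) - star (alpha x) (star y z) =
      star (star y x) (alpha z) - star (alpha y) (star x z)
}.

Record Hom_Novikov_Poisson mul star alpha : Prop := HomNovikovPoisson {
  hnp_multiplicative : multiplicative_for mul alpha;
  hnp_Hom_Novikov : Hom_Novikov star alpha;
  hnp_comm_Hom_associative : comm_Hom_associative mul alpha;
  hnp_mul_star :
    forall x y z, star (mul x y) (alpha z) = mul (alpha x) (star y z);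
  hnp_compatibility :
    forall x y z,
      mul (star x y) (alpha z) - star (alpha x) (mul y z) =
      mul (star y x) (alpha z) - star (alpha y) (mul x z)
}.

Definition derivation_product mul d : A -> A -> A := fun x y => mul x (d y).

End HomAlgebras.

(* Main.v *)
Require Import Defs.
From mathcomp Require Import all_boot all_algebra.

(** Since [d] commutes with [alpha], every twisted factor [d (alpha z)] of the
    new product can be read as [alpha (d z)], to which Hom-associativity
    applies; this already gives [(x . y) * alpha z = alpha x . (y * z)] and,
    with commutativity, the right-commutative law.  In the two laws that
    compare associators, the Leibniz rule splits [d (y . w)], the summand with
    [d] on [y] cancels, and what remains is [- (x . y) . alpha (d w)], visibly
    symmetric in [x] and [y].  This single cancellation,
    [associator_derivation], is used with [w = d z] for the left symmetry of
    the Novikov product and with [w = z] for its compatibility with the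
    commutative product. *)

Import GRing.Theory.
Local Open Scope ring_scope.

Lemma bilinear_derivation_product (F : fieldType) (A : lmodType F)
    (mul : A -> A -> A) (d : A -> A) :
  bilinear_op mul -> linear d -> bilinear_op (derivation_product mul d).
Proof.
move=> [mulDl mulDr] d_linear; split=> [y a u v | x a u v] /=.
  exact: mulDl.
by rewrite /derivation_product d_linear mulDr.
Qed.

(** The difference is the failure of [d] to move past a product: the summand
    of [d (y . w)] with [d] on [y] is the first term by Hom-associativity, so
    only the summand with [d] on [w] survives. *)
Lemma associator_derivation (F : fieldType) (A : lmodType F)
    (mul : A -> A -> A) (alpha d : A -> A) :
    comm_Hom_associative mul alpha -> derivation mul d ->
  forall x y w,
    mul (mul x (d y)) (alpha w) - mul (alpha x) (d (mul y w)) =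
    - mul (mul x y) (alpha (d w)).
Proof.
move=> [[_ mulDr] _ _ mulA] [_ d_mul] x y w.
have mul_add u v t : mul u (v + t) = mul u v + mul u t.
  by have /= := mulDr u 1 v t; rewrite !scale1r.
by rewrite d_mul mul_add !mulA opprD addrA subrr add0r.
Qed.

Theorem theorem5p3 (F : fieldType) (charF0 : [pchar F]%R =i pred0)
    (A : lmodType F) (mul : A -> A -> A) (alpha d : A -> A)
    (mul_alpha_cha : comm_Hom_associative mul alpha)
    (alpha_mul : multiplicative_for mul alpha)
    (d_derivation : derivation mul d)
    (d_alpha : forall x : A, d (alpha x) = alpha (d x)) :
  Hom_Novikov_Poisson mul (derivation_product mul d) alpha.
Proof.
have assoc_d := associator_derivation _ _ _ _ _ mul_alpha_cha d_derivation.
have [mul_bilinear alpha_linear mulC mulA] := mul_alpha_cha.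
have [d_linear _] := d_derivation.
split=> //; last 2 first.
- by move=> x y z; rewrite /derivation_product d_alpha mulA.
- by move=> x y z; rewrite /derivation_product !assoc_d (mulC x y).
split=> //.
- exact: bilinear_derivation_product.
- by move=> x y; rewrite /derivation_product alpha_mul d_alpha.
- move=> x y z; rewrite /derivation_product !d_alpha -!mulA.
  by rewrite (mulC (d y)).
- by move=> x y z; rewrite /derivation_product !d_alpha !assoc_d (mulC x y).
Qed.
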